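(* Let $T=2B$ acting on $\ell^2(\mathbb Z_+)$, where $B$ is the unweighted backward shift, and let $(f(n))$ be a sequence of positive integers with $f(n+1)>af(n)$ for all $n\in\mathbb N$, for some $a>1$. Then for every $x\in HC(T)$ there exists $\theta\in\mathbb R$ such that the set $\{e^{2\pi i f(n)\theta}T^n x;\ n\geq 1\}$ is not dense in $\ell^2(\mathbb Z_+)$.
   Context: $\ell^2(\mathbb Z_+)$ is the complex Hilbert space of square-summable sequences indexed by $n\geq 0$, with standard basis $(e_n)_{n\geq 0}$; $B$ is the bounded operator with $Be_0=0$ and $Be_n=e_{n-1}$ for $n\geq 1$. $HC(T)$ is the set of hypercyclic vectors for $T$, i.e. vectors $x$ such that $\{T^n x;\ n\geq 0\}$ is dense. *)

(* Defs.v *)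
From HB Require Import structures.
From mathcomp Require Import all_boot all_order all_algebra.
From mathcomp Require Import complex.
From mathcomp Require Import boolp classical_sets functions reals topology.
From mathcomp Require Import normedtype sequences exp trigo.
From mathcomp Require Import ring lra.

Set Implicit Arguments.
Unset Strict Implicit.
Unset Printing Implicit Defensive.

Import Order.TTheory GRing.Theory Num.Theory ComplexField.Normc.
Import numFieldNormedType.Exports.

Local Open Scope classical_set_scope.
Local Open Scope complex_scope.
Local Open Scope ring_scope.

Arguments normc : simpl never.

(* e^{it} for a real t *)
Definition expi {R : realType} (t : R) : R[i] := cos t +i* sin t.

(* HC(T) *)
Definition hypercyclic {V : topologicalType} (T : V -> V) : set V :=
  [set x | dense [set iter n T x | n in [set: nat]]].

Definition square_summable {R : realType} (x : nat -> R[i]) : Prop :=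
  cvgn (series (fun n => normc (x n) ^+ 2 : R)).

Section ell2_pred.
Context {R : realType}.
Implicit Types x y : nat -> R[i].

Lemma normc_ge0 (z : R[i]) : 0 <= normc z.
Proof. by case: z => a b; exact: sqrtr_ge0. Qed.

Lemma complex_normE (z : R[i]) : `|z| = (normc z)%:C.
Proof. by []. Qed.

Lemma normc_leD (z w : R[i]) : normc (z + w) <= normc z + normc w.
Proof. exact: le_normcD. Qed.

Lemma series_bounded_cvg (u : nat -> R) (M : R) : (forall n, 0 <= u n) ->
  (forall n, series u n <= M) -> cvgn (series u) /\ limn (series u) <= M.
Proof.
move=> u0 uM.
have cu : cvgn (series u).
  apply: nondecreasing_is_cvgn; first exact: nondecreasing_series.
  by exists M => _ [n _ <-].
by split=> //; apply: limr_le => //; near=> n.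
Unshelve. all: by end_near. Qed.

Lemma series_le_lim (u : nat -> R) n : (forall n, 0 <= u n) ->
  cvgn (series u) -> series u n <= limn (series u).
Proof.
by move=> u0 cu; apply: nondecreasing_cvgn_le => //; exact: nondecreasing_series.
Qed.

Lemma term_le_lim (u : nat -> R) n : (forall n, 0 <= u n) ->
  cvgn (series u) -> u n <= limn (series u).
Proof.
move=> u0 cu; apply: le_trans (series_le_lim n.+1 u0 cu).
by rewrite seriesS lerDl /series/= sumr_ge0.
Qed.

Lemma square_summable0 : square_summable (fun=> 0 : R[i]).
Proof.
apply: (@series_bounded_cvg _ 0 _ _).1 => n; first exact: exprn_ge0 (normc_ge0 _).
by rewrite /series/= big1// => i _; rewrite normc0 expr0n.
Qed.

Lemma square_summableD x y : square_summable x -> square_summable y ->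
  square_summable (fun n => x n + y n).
Proof.
move=> cx cy.
have c2 := is_cvg_seriesZ (k := 2) (is_cvg_seriesD cx cy).
apply: series_le_cvg c2 => n.
- exact: exprn_ge0 (normc_ge0 _).
- by rewrite mulr_ge0 ?addr_ge0 ?exprn_ge0 ?normc_ge0.
- rewrite -[leRHS]/(2 * (normc (x n) ^+ 2 + normc (y n) ^+ 2)).
  have := normc_leD (x n) (y n); have := normc_ge0 (x n + y n).
  move: (normc (x n + y n)) (normc (x n)) (normc (y n)) => r p q r0 rpq.
  have rr : r ^+ 2 <= (p + q) ^+ 2.
    by rewrite ler_sqr ?nnegrE// (le_trans r0).
  by have := sqr_ge0 (p - q); nra.
Qed.

Lemma square_summableZ (c : R[i]) x : square_summable x ->
  square_summable (fun n => c * x n).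
Proof.
move=> cx; have := is_cvg_seriesZ (k := normc c ^+ 2) cx.
by congr (cvgn (series _)); apply/funext => n; rewrite normcM exprMn.
Qed.

Lemma square_summable_shift x : square_summable x ->
  square_summable (fun n => x n.+1).
Proof.
move=> cx; have x0 n : 0 <= normc (x n) ^+ 2 by rewrite exprn_ge0 ?normc_ge0.
apply: (@series_bounded_cvg _ _ _ _).1 => n; first exact: x0.
apply: le_trans (series_le_lim n.+1 x0 cx).
by rewrite /series/= [leRHS]big_nat_recl// lerDr x0.
Qed.

Definition ell2_pred : {pred nat -> R[i]} := [pred x | `[< square_summable x >]].

Lemma ell2_submod_closed : submod_closed ell2_pred.
Proof.
split=> [|c x y /asboolP cx /asboolP cy].
  by apply/asboolP; exact: square_summable0.
apply/asboolP/square_summableD => //.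
exact: (square_summableZ (c := c) cx).
Qed.

HB.instance Definition _ :=
  GRing.isSubmodClosed.Build R[i] (nat -> R[i]) ell2_pred ell2_submod_closed.

End ell2_pred.

(* The complex Hilbert space l^2(Z_+), as a normed space over R[i]. *)
Record ell2 (R : realType) := Ell2 {
  ell2_val :> nat -> R[i];
  ell2_valP : ell2_val \in ell2_pred }.

Section ell2_normed.
Context {R : realType}.

HB.instance Definition _ := [isSub for @ell2_val R].
HB.instance Definition _ := [Choice of ell2 R by <:].
HB.instance Definition _ := [SubChoice_isSubLmodule of ell2 R by <:].

Implicit Types x y : ell2 R.

Lemma ell2_summable x : square_summable x.
Proof. by have /asboolP := ell2_valP x. Qed.
Arguments ell2_summable : clear implicits.

Lemma ell2_ext x y : (forall n, x n = y n) -> x = y.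
Proof. by move=> xy; apply/val_inj/funext. Qed.

Lemma ell2D x y n : (x + y) n = x n + y n. Proof. by []. Qed.
Lemma ell2Z (c : R[i]) x n : (c *: x) n = c * x n. Proof. by []. Qed.

Definition ell2_sqnorm x : R := limn (series (fun n => normc (x n) ^+ 2)).
Definition ell2_norm x : R := Num.sqrt (ell2_sqnorm x).

Let sq_ge0 x n : 0 <= normc (x n) ^+ 2.
Proof. by rewrite exprn_ge0 ?normc_ge0. Qed.

Lemma ell2_sqnorm_ge0 x : 0 <= ell2_sqnorm x.
Proof.
exact: le_trans (sq_ge0 x 0%N) (term_le_lim 0%N (sq_ge0 x) (ell2_summable x)).
Qed.

Lemma ell2_norm_ge0 x : 0 <= ell2_norm x.
Proof. exact: sqrtr_ge0. Qed.

Lemma sqr_ell2_norm x : ell2_norm x ^+ 2 = ell2_sqnorm x.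
Proof. by rewrite sqr_sqrtr ?ell2_sqnorm_ge0. Qed.

Lemma ell2_coord_le x n : normc (x n) <= ell2_norm x.
Proof.
rewrite -ler_sqr ?nnegrE ?normc_ge0 ?ell2_norm_ge0// sqr_ell2_norm.
exact: (term_le_lim n (sq_ge0 x) (ell2_summable x)).
Qed.

Lemma ell2_norm_le x (M : R) : 0 <= M ->
  (forall n, series (fun n => normc (x n) ^+ 2) n <= M ^+ 2) -> ell2_norm x <= M.
Proof.
move=> M0 H; rewrite -ler_sqr ?nnegrE ?ell2_norm_ge0// sqr_ell2_norm.
exact: (series_bounded_cvg (sq_ge0 x) H).2.
Qed.

Lemma ell2_norm_eq0 x : ell2_norm x = 0 -> x = 0.
Proof.
move=> x0; apply: ell2_ext => n; apply: eq0_normc; apply/eqP.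
by rewrite eq_le normc_ge0 andbT -x0 ell2_coord_le.
Qed.

Lemma ell2_normZ (c : R[i]) x : ell2_norm (c *: x) = normc c * ell2_norm x.
Proof.
rewrite /ell2_norm -[X in X * _](ger0_norm (normc_ge0 c)) -sqrtr_sqr.
rewrite -sqrtrM ?sqr_ge0//; congr Num.sqrt.
rewrite -[RHS]/(normc c ^+ 2 *: ell2_sqnorm x) -lim_seriesZ; last exact: ell2_summable.
by congr (limn (series _)); apply/funext => n; rewrite normcM exprMn.
Qed.

Lemma ell2_normD x y : ell2_norm (x + y) <= ell2_norm x + ell2_norm y.
Proof.
have [A0|A0] := eqVneq (ell2_norm x) 0.
  by rewrite A0 (ell2_norm_eq0 A0) !add0r.
have [B0|B0] := eqVneq (ell2_norm y) 0.
  by rewrite B0 (ell2_norm_eq0 B0) !addr0.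
have Ap : 0 < ell2_norm x by rewrite lt0r A0 ell2_norm_ge0.
have Bp : 0 < ell2_norm y by rewrite lt0r B0 ell2_norm_ge0.
apply: ell2_norm_le => [|n]; first by rewrite addr_ge0 ?ell2_norm_ge0.
have sx := series_le_lim n (sq_ge0 x) (ell2_summable x).
have sy := series_le_lim n (sq_ge0 y) (ell2_summable y).
rewrite -[leRHS]/(ell2_sqnorm x) -sqr_ell2_norm in sx.
rewrite -[leRHS]/(ell2_sqnorm y) -sqr_ell2_norm in sy.
move: (ell2_norm x) (ell2_norm y) Ap Bp sx sy {A0 B0} => A B Ap Bp sx sy.
have pw (p q r : R) : 0 <= r -> r <= p + q ->
    r ^+ 2 <= (A + B) / A * p ^+ 2 + (A + B) / B * q ^+ 2.
  move=> r0 rpq.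
  have -> : (A + B) / A * p ^+ 2 + (A + B) / B * q ^+ 2 =
      (p + q) ^+ 2 + (B * p - A * q) ^+ 2 / (A * B).
    by field; rewrite !gt_eqF.
  apply: (@le_trans _ _ ((p + q) ^+ 2)).
    by rewrite ler_sqr ?nnegrE// (le_trans r0).
  by rewrite lerDl divr_ge0 ?sqr_ge0// mulr_ge0 ?ltW.
apply: (@le_trans _ _ ((A + B) / A * series (fun n => normc (x n) ^+ 2) n
    + (A + B) / B * series (fun n => normc (y n) ^+ 2) n)).
  rewrite /series/= !mulr_sumr -big_split/=; apply: ler_sum => i _.
  by apply: pw; [exact: normc_ge0|exact: normc_leD].
have -> : (A + B) ^+ 2 = (A + B) / A * A ^+ 2 + (A + B) / B * B ^+ 2.
  by field; rewrite !gt_eqF.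
by apply: lerD; rewrite ler_pM2l// divr_gt0 ?addr_gt0.
Qed.

Let norm x : R[i] := (ell2_norm x)%:C.

Let normD x y : norm (x + y) <= norm x + norm y.
Proof. by rewrite -rmorphD/= lecR ell2_normD. Qed.

Let normZ (c : R[i]) x : norm (c *: x) = `|c| * norm x.
Proof. by rewrite /norm ell2_normZ rmorphM. Qed.

Let norm_eq0 x : norm x = 0 -> x = 0.
Proof. by move=> /complexI; exact: ell2_norm_eq0. Qed.

HB.instance Definition _ :=
  Lmodule_isNormed.Build R[i] (ell2 R) normD normZ norm_eq0.

Lemma ell2_normE x : `|x| = (Num.sqrt (ell2_sqnorm x))%:C.
Proof. by []. Qed.

End ell2_normed.

Arguments ell2_summable {R} x.

Section ell2_basis.
Context {R : realType}.

Let ebase_fun (n : nat) : nat -> R[i] := fun k => (k == n)%:R.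

Let ebase_pred n : ebase_fun n \in ell2_pred.
Proof.
apply/asboolP; apply: (@series_bounded_cvg _ _ 1 _ _).1 => m.
  by rewrite exprn_ge0 ?normc_ge0.
rewrite /series/= /ebase_fun.
have H : forall k, normc ((k == n)%:R : R[i]) ^+ 2 = (k == n)%:R.
  by move=> k; case: (k == n); rewrite ?normc1 ?normc0 ?expr1n ?expr0n.
under eq_bigr do rewrite H.
have [nm|mn] := ltnP n m.
  rewrite (bigD1_seq n) ?mem_index_iota ?iota_uniq//= eqxx big1 ?addr0//.
  by move=> k /negbTE ->.
rewrite big_nat_cond big1// => k /andP[/andP[_ km] _].
by rewrite ltn_eqF// (leq_trans km).
Qed.

Definition ebase n : ell2 R := Ell2 (ebase_pred n).

End ell2_basis.

Section bshift.
Context {R : realType}.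

Let bshift_pred (x : ell2 R) : (fun n => x n.+1) \in ell2_pred.
Proof. exact/asboolP/square_summable_shift/ell2_summable. Qed.

(* The backward shift B. The lemmas below show that it is the bounded operator
   with B e_0 = 0 and B e_{n+1} = e_n. *)
Definition bshift (x : ell2 R) : ell2 R := Ell2 (bshift_pred x).

Let bshift_linear : linear bshift.
Proof. by move=> c x y; exact: ell2_ext. Qed.

HB.instance Definition _ :=
  GRing.isLinear.Build R[i] (ell2 R) (ell2 R) _ bshift bshift_linear.

Lemma bshift_norm_le (x : ell2 R) : `|bshift x| <= `|x|.
Proof.
rewrite lecR; apply: ell2_norm_le => [|n]; first exact: ell2_norm_ge0.
have x0 m : 0 <= normc (x m) ^+ 2 by rewrite exprn_ge0 ?normc_ge0.
rewrite sqr_ell2_norm; apply: le_trans (series_le_lim n.+1 x0 (ell2_summable x)).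
by rewrite /series/= [leRHS]big_nat_recl// lerDr x0.
Qed.

Lemma bshift_continuous : continuous bshift.
Proof.
apply: bounded_linear_continuous; apply/linear_boundedP.
exists 1; split; first exact: real1.
move=> M M1 x; apply: le_trans (bshift_norm_le x) _.
by rewrite -[leLHS]mul1r ler_wpM2r// ltW.
Qed.

Lemma bshift_ebase0 : bshift (ebase 0) = 0.
Proof. exact: ell2_ext. Qed.

Lemma bshift_ebaseS n : bshift (ebase n.+1) = ebase n.
Proof. exact: ell2_ext. Qed.

End bshift.

(* Main.v *)
Require Import Defs.
From mathcomp Require Import all_boot all_order all_algebra.
From mathcomp Require Import complex.
From mathcomp Require Import boolp classical_sets functions reals topology.
From mathcomp Require Import normedtype sequences exp trigo.
From mathcomp Require Import zify ring lra.

Import Order.TTheory GRing.Theory Num.Theory.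
Import numFieldNormedType.Exports.
Import ComplexField.Normc.

Local Open Scope classical_set_scope.
Local Open Scope ring_scope.

(** The orbit of [x] is not dense along the rotated times because it avoids a
small ball around [e_0].  Call [n] a return time when some rotation of
[T^n x] is within [e] of [e_0]; only return times matter.

- Return times are far apart ([close_returns_separated]).  If [T^m x] is
  [e]-close to a rotation of [e_0], its coordinates of index [k > 0] have modulus
  smaller than [e], and the coordinate of index [0] of [T^(m+k) x] is the [k]-th one of
  [T^m x] multiplied by [2^k].  So [m + k] is not a return time as long as
  [2^k e <= 1 - e].  Taking [e] small makes consecutive return times differ by
  more than any prescribed [N], hence makes [f] grow along the return times by
  a factor at least [a^N], as large as desired.
- With such a growth, [theta] can be chosen freely at every return time
  ([lacunary_arcs]): nested intervals give a [theta] such that every [f(n) theta]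
  lies modulo [1] in a prescribed arc of length [1/4].
- An arc of that length is enough to turn the coordinate of index [0] of [T^n x]
  into the half-plane [Re <= 0] ([quarter_turn_Re_le0]), all of whose
  points are at distance at least [1 >= e] from [1], the coordinate of [e_0]. *)

Lemma periodicz {U V : zmodType} (f : U -> V) (T : U) : periodic f T ->
  forall (k : int) a, f (a + T *~ k) = f a.
Proof.
move=> fT [n|n] a; first by rewrite -pmulrn; exact: periodicn fT n a.
by rewrite NegzE mulrNz -pmulrn -(periodicn fT n.+1 (a - _)) subrK.
Qed.

Lemma normc_expi {R : realType} (t : R) : normc (expi t) = 1.
Proof. by rewrite /normc/= cos2Dsin2 sqrtr1. Qed.

(** Rotating the quadrant of [z] from the second quadrant to the third takes a
quarter turn, during which the rotated [z] stays in [Re <= 0].  The constant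
[c] depends only on the quadrant of [z], so no argument of [z] has to be
chosen. *)
Lemma quarter_turn_Re_le0 {R : realType} (z : R[i]) :
  exists c : R, forall (t : R) (k : int), c + k%:~R <= t <= c + k%:~R + 1 / 4 ->
    complex.Re (expi (2 * pi * t) * z) <= 0.
Proof.
have [p0 pi2] : 0 < (pi : R) /\ (pi : R) *+ 2 = 2 * pi.
  by rewrite pi_gt0 mulr_natl.
case: z => u v.
suff [c cP] : exists c : R, forall s : R, c <= s <= c + 1 / 4 ->
    cos (2 * pi * s) * u - sin (2 * pi * s) * v <= 0.
  exists c => t k tk; rewrite /expi/=.
  have -> : 2 * pi * t = 2 * pi * (t - k%:~R) + pi *+ 2 *~ k.
    by rewrite pi2 -[_ *~ k]mulrzr; ring.
  rewrite (periodicz _ _ (@cosD2pi R)) (periodicz _ _ (@sinD2pi R)).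
  by apply: cP; lra.
have quadrant (s : R) : 0 <= s <= 1 / 4 ->
    0 <= cos (2 * pi * s) /\ 0 <= sin (2 * pi * s).
  by move=> s14; split; [apply: cos_ge0_pihalf|apply: sin_ge0_pi]; nra.
have [u0|u0] := lerP u 0; have [v0|v0] := lerP 0 v.
- by exists 0 => s s14; have := quadrant s; nra.
- exists (3 / 4) => s s14; have [|c0 s0] := quadrant (s - 3 / 4); first by lra.
  have -> : 2 * pi * s = 2 * pi * (s - 3 / 4) + pi / 2 + pi by field.
  by rewrite cosDpi sinDpi cosDpihalf sinDpihalf; nra.
- exists (1 / 4) => s s14; have [|c0 s0] := quadrant (s - 1 / 4); first by lra.
  have -> : 2 * pi * s = 2 * pi * (s - 1 / 4) + pi / 2 by field.
  by rewrite cosDpihalf sinDpihalf; nra.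
- exists (1 / 2) => s s14; have [|c0 s0] := quadrant (s - 1 / 2); first by lra.
  have -> : 2 * pi * s = 2 * pi * (s - 1 / 2) + pi by field.
  by rewrite cosDpi sinDpi; nra.
Qed.

(** Between two consecutive indices of [E] the ratio of [q] is at least
[(1 + w) / w], so an interval of length [w / q m] is stretched by [q n] to
length at least [1 + w], hence contains a whole translate of the arc
[[c n, c n + w]].  The nested intervals are [[s n.+1, s n.+1 + w / q n]] for
[n] in [E], each [s n.+1] being the first admissible point after [s n]; [theta]
is the supremum of [s]. *)
Lemma lacunary_arcs {R : realType} (E : pred nat) (q c : nat -> R) (w : R) :
  0 < w ->
  (forall n, E n -> 0 < q n) ->
  (forall m n, E m -> E n -> (m < n)%N -> (1 + w) * q m <= w * q n) ->
  exists theta : R, forall n, E n ->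
    exists k : int, c n + k%:~R <= q n * theta <= c n + k%:~R + w.
Proof.
move=> w0 q0 qlac.
pose ceilarc n (s : R) : R := c n + (Num.ceil (q n * s - c n))%:~R.
pose s := fix s n := if n is m.+1 then
  (if E m then ceilarc m (s m) / q m else s m) else 0.
have arcP n t : q n * t <= ceilarc n t <= q n * t + 1.
  rewrite /ceilarc; have := ceil_itv (q n * t - c n).
  by rewrite intrB /= => ?; lra.
have sS n : s n <= s n.+1.
  rewrite /=; case: ifP => // En; have := arcP n (s n); have := q0 n En.
  by move=> qn arcn; rewrite ler_pdivlMr//; lra.
have s_incr m n : (m <= n)%N -> s m <= s n.
  exact: (homo_leq (@lexx _ _) (@le_trans _ _)).
(* Here e is the last index of E below n: the term w / q e in the left-hand
   side is what absorbs the increments of s still to come. *)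
have trap m n : E m -> (m < n)%N -> exists e, [/\ E e, (e < n)%N &
    s n + w / q e <= s m.+1 + w / q m].
  move=> Em; elim: n => // n IHn; rewrite ltnS leq_eqVlt => /predU1P[<-|mn].
    by exists m.
  have [e [Ee en IHe]] := IHn mn; rewrite [s n.+1]/=; case: ifP => En; last first.
    by exists e; split=> //; exact: ltnW.
  exists n; split=> //; apply: le_trans IHe.
  have := qlac e n Ee En en; have := arcP n (s n).
  have := q0 e Ee; have := q0 n En; move: (ceilarc n (s n)) => A qn qe hA hq.
  rewrite -mulrDl ler_pdivrMr// mulrDl.
  suff : 1 + w <= w / q e * q n by lra.
  by rewrite mulrAC ler_pdivlMr.
have s_ub m n : E m -> s n <= s m.+1 + w / q m.
  move=> Em; have wq : 0 <= w / q m by rewrite divr_ge0 ?ltW ?q0.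
  have [nm|mn] := leqP n m.
    by apply: le_trans (s_incr _ _ (leqW nm)) _; rewrite lerDl.
  have [e [Ee _]] := trap m n Em mn; apply: le_trans.
  by rewrite lerDl divr_ge0 ?ltW ?q0.
exists (sup (range s)) => n En; exists (Num.ceil (q n * s n - c n)).
have qn := q0 n En.
have sn : q n * s n.+1 = ceilarc n (s n) by rewrite /= En mulrC divfK ?gt_eqF.
rewrite -/(ceilarc n (s n)) -sn; apply/andP; split.
  rewrite ler_pM2l//; apply: ub_le_sup; last by exists n.+1.
  by exists (s n.+1 + w / q n) => _ [j _ <-]; exact: s_ub.
have -> : q n * s n.+1 + w = q n * (s n.+1 + w / q n).
  by rewrite mulrDr mulrCA divff ?mulr1// gt_eqF.
rewrite ler_pM2l//; apply: ge_sup; first by exists (s 0%N), 0%N.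
by move=> _ [j _ <-]; exact: s_ub.
Qed.

Section doubled_shift.
Context {R : realType}.
Implicit Types x : ell2 R.

Let T : ell2 R -> ell2 R := 2 \*: @bshift R.

Lemma iter_shiftE n x k : iter n T x k = 2 ^+ n * x (n + k)%N.
Proof.
elim: n k => [|n IHn] k; first by rewrite mul1r.
by rewrite iterS -[LHS]/(2 * iter n T x k.+1) IHn mulrA -exprS addnS.
Qed.

Lemma normc_2X n : normc (2 ^+ n : R[i]) = 2 ^+ n.
Proof.
elim: n => [|n IHn]; first by rewrite !expr0 normc1.
by rewrite !exprS normcM IHn -[2 in LHS]/(1 *+ 2) normcMn normc1.
Qed.

(** The first bound makes the [k]-th coordinate of [T^m x] smaller than [e] in
modulus; the second makes [2^k] times that coordinate larger than [1 - e]. *)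
Lemma close_returns_separated x (e t t' : R) m k : (0 < k)%N ->
  ell2_norm (ebase 0 - expi t *: iter m T x) < e ->
  ell2_norm (ebase 0 - expi t' *: iter (m + k) T x) < e ->
  1 < (2 ^+ k + 1) * e.
Proof.
move=> k0 dm dn.
have {dm} := le_lt_trans (ell2_coord_le _ k) dm.
have {dn} := le_lt_trans (ell2_coord_le _ 0) dn.
rewrite -[(ebase 0 - expi t' *: iter (m + k) T x) _]
  /(1 - expi t' * iter (m + k) T x 0%N).
rewrite -[(ebase 0 - expi t *: iter m T x) _]
  /((k == 0)%:R - expi t * iter m T x k).
rewrite (gtn_eqF k0) sub0r normcN normcM normc_expi mul1r.
have -> : iter (m + k) T x 0%N = 2 ^+ k * iter m T x k.
  by rewrite !iter_shiftE addn0 exprD; ring.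
move: (iter m T x k) => z dn dm.
have := normc_leD (1 - expi t' * (2 ^+ k * z)) (expi t' * (2 ^+ k * z)).
rewrite subrK normc1 !normcM normc_expi normc_2X mul1r => d1.
have d2 : 2 ^+ k * normc z < 2 ^+ k * e by rewrite ltr_pM2l ?exprn_gt0.
by rewrite mulrDl mul1r; lra.
Qed.

Lemma Re_le0_far_from_ebase0 x (t : R) n :
  complex.Re (expi t * iter n T x 0%N) <= 0 ->
  1 <= ell2_norm (ebase 0 - expi t *: iter n T x).
Proof.
move=> Re0; apply: le_trans (ell2_coord_le _ 0).
rewrite -[(ebase 0 - expi t *: iter n T x) _]/(1 - expi t * iter n T x 0%N).
move: (expi t * _) Re0 => [u v] /= u0.
rewrite /normc/= -[leLHS]sqrtr1 ler_wsqrtr//.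
by have := sqr_ge0 (0 - v); nra.
Qed.

End doubled_shift.

(** Bernoulli's inequality and the Archimedean property. *)
Lemma expr_archi {R : realType} (a b : R) : 1 < a ->
  exists N, b <= a ^+ N.
Proof.
move=> a1; have bern N : 1 + N%:R * (a - 1) <= a ^+ N.
  elim: N => [|N IHN]; first by rewrite mul0r addr0.
  rewrite exprS -natr1; have aIH := ler_wpM2l (ltW (lt_trans ltr01 a1)) IHN.
  apply: le_trans aIH; have : 0 <= N%:R * (a - 1) ^+ 2.
    by rewrite mulr_ge0 ?sqr_ge0.
  by lra.
have bN := archi_boundP (normr_ge0 (b / (a - 1))); set N := Num.bound _ in bN.
exists N; apply: le_trans (bern N).
have : b / (a - 1) <= N%:R by rewrite (le_trans (ler_norm _))// ltW.
by rewrite ler_pdivrMr ?subr_gt0//; lra.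
Qed.

Theorem proposition4p1 (R : realType) (f : nat -> nat) (a : R)
    (f_gt0 : forall n : nat, (1 <= n)%N -> (0 < f n)%N)
    (a_gt1 : 1 < a)
    (f_lacunary : forall n : nat, (1 <= n)%N -> a * (f n)%:R < (f n.+1)%:R)
    (x : ell2 R) :
  hypercyclic (2 \*: @bshift R) x ->
  exists theta : R,
    ~ dense [set expi (2 * pi * (f n)%:R * theta) *: iter n (2 \*: @bshift R) x
              | n in [set n : nat | (1 <= n)%N]].
Proof.
move=> _.
have f_growth m k : (1 <= m)%N -> a ^+ k * (f m)%:R <= (f (m + k)%N)%:R.
  move=> m1; elim: k => [|k IHk]; first by rewrite mul1r addn0.
  rewrite addnS exprS -mulrA; apply: (le_trans _ (ltW (f_lacunary _ _))).
    by rewrite ler_pM2l// (lt_trans ltr01).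
  exact: leq_trans m1 (leq_addr _ _).
(* 5 is the ratio (1 + w) / w for arcs of length w = 1 / 4, and e is the
   largest radius that excludes returns after at most N steps. *)
have [N aN] := expr_archi a 5 a_gt1.
pose e : R := (2 ^+ N + 1)^-1.
have pow2 n : 1 <= 2 ^+ n :> R by rewrite exprn_ege1// ler1n.
have D0 : 0 < 2 ^+ N + 1 :> R by have := pow2 N; lra.
have e0 : 0 < e by rewrite invr_gt0.
have e1 : e <= 1 by rewrite invf_le1//; have := pow2 N; lra.
pose E : pred nat := fun n => (1 <= n)%N && `[< exists t : R,
  ell2_norm (ebase 0 - expi t *: iter n (2 \*: @bshift R) x) < e >].
have [c cP] := choice (fun n =>
  quarter_turn_Re_le0 (iter n (2 \*: @bshift R) x 0%N)).
have [|n|m n|theta thetaP] := @lacunary_arcs R E (fun n => (f n)%:R) c (1 / 4).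
- by lra.
- by move=> /andP[n1 _]; rewrite ltr0n f_gt0.
- move=> /andP[m1 /asboolP[t tm]] /andP[n1 /asboolP[t' tn]] mn.
  have [k k0 def_n] : exists2 k, (0 < k)%N & n = (m + k)%N.
    by exists (n - m)%N; lia.
  rewrite def_n in tn *.
  have sep := close_returns_separated x e t t' m k k0 tm tn.
  have Nk : (N <= k)%N.
    rewrite leqNgt; apply/negP => kN; move: sep; apply/negP; rewrite -leNgt.
    rewrite ler_pdivrMr// mul1r lerD2r.
    by rewrite ler_eXn2l ?ltr1n // ltnW.
  have a5 : 5 <= a ^+ k by apply: le_trans aN _; rewrite ler_eXn2l.
  have := ler_wpM2r (ler0n R (f m)) a5; have := f_growth m k m1; lra.
exists theta => dns.
have [||y [yball [n /= n1 def_y]]] := dns (ball (ebase 0 : ell2 R) e%:C%C).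
- by exists (ebase 0); apply: ballxx; rewrite ltcR.
- exact: ball_open.
move: yball; rewrite -def_y -ball_normE/= ltcR => dn.
have En : E n by apply/andP; split=> //; apply/asboolP; eexists; exact: dn.
have [k thetak] := thetaP n En.
have := Re_le0_far_from_ebase0 x _ n (cP n _ k thetak).
by rewrite mulrA leNgt (lt_le_trans dn e1).
Qed.
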